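(* \begin{enumerate} \item[(i)] For $n^3\ll e\ll n^{40/13}$ we have $\mathrm{un}_4(n,e)\lesssim e^{4/3}/n^{10/3}$. \item[(ii)] For $n^{40/13}\ll e\le \binom{n}{4}$ we have $\mathrm{un}_4(n,e)\lesssim \frac{e^{1/4}\log n}{\log\left(\binom{n}{4}/e\right)}$. \end{enumerate}
   Context: A $4$-graph $\mathcal{H}$ is $(n,e)$-unavoidable if every $4$-graph ($4$-uniform hypergraph) on $n$ vertices with $e$ edges contains a copy of $\mathcal{H}$; $\mathrm{un}_4(n,e)$ is the maximum number of edges of an $(n,e)$-unavoidable $4$-graph. $f\lesssim g$ means $f\le Dg$ for an absolute constant $D$; $a\ll b$ means $a\le cb$ for a suitable absolute constant $c>0$ (so e.g. (i) is asserted for $C_0n^3\le e\le c_0n^{40/13}$ with suitable absolute constants $C_0,c_0$), for all sufficiently large $n$. *)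

(* Defs.v *)
From mathcomp Require Import all_boot all_order all_algebra.
From mathcomp Require Import all_classical all_reals all_analysis.

Set Implicit Arguments.
Unset Strict Implicit.
Unset Printing Implicit Defensive.

Local Open Scope classical_set_scope.
Local Open Scope nat_scope.

Definition uniform (k : nat) (V : finType) (H : {set {set V}}) : Prop :=
  forall A, A \in H -> #|A| = k.

(* The vertex map is injective on all of [W], so isolated vertices of [H]
   count: a copy of [H] needs [#|W|] distinct vertices. *)
Definition contains_copy (W V : finType) (H : {set {set W}})
    (G : {set {set V}}) : Prop :=
  exists2 f : W -> V, injective f & forall A, A \in H -> f @: A \in G.

Definition unavoidable (k n e : nat) (W : finType) (H : {set {set W}}) : Prop :=
  forall (V : finType) (G : {set {set V}}),
    #|V| = n -> uniform k G -> #|G| = e -> contains_copy H G.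

Definition unavoidable_sizes (k n e : nat) : set nat :=
  [set m | exists (W : finType) (H : {set {set W}}),
    [/\ uniform k H, unavoidable k n e H & #|H| = m]].

(* The value is the junk [0] if there is no maximum; by [un_max] below this
   does not happen for [e <= 'C(n, k)]. *)
Definition un (k n e : nat) : nat :=
  xget 0 [set m | unavoidable_sizes k n e m /\
                  forall m', unavoidable_sizes k n e m' -> m' <= m].

Lemma exists_uniform (k n e : nat) : e <= 'C(n, k) ->
  exists G : {set {set 'I_n}}, uniform k G /\ #|G| = e.
Proof.
move=> le_e; set D := [set A : {set 'I_n} | #|A| == k]%SET.
have szD : size (enum D) = 'C(n, k) by rewrite -cardE card_draws card_ord.
exists [set A in take e (enum D)]%SET; split.
  by move=> A; rewrite inE => /mem_take; rewrite mem_enum inE => /eqP.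
rewrite cardsE (card_uniqP _) ?size_takel ?szD //.
by rewrite take_uniq ?enum_uniq.
Qed.

Lemma un_max (k n e : nat) : e <= 'C(n, k) ->
  unavoidable_sizes k n e (un k n e) /\
  forall m, unavoidable_sizes k n e m -> m <= un k n e.
Proof.
move=> le_e.
have [G [Gk Ge]] := exists_uniform le_e.
have ub m : unavoidable_sizes k n e m -> m <= e.
  move=> [W [H [_ /(_ _ G (card_ord n) Gk Ge) [f finj fH] <-]]].
  rewrite -(card_imset _ (imset_inj finj)) -Ge subset_leq_card //.
  by apply/fintype.subsetP => _ /imsetP[A AH ->]; exact: fH.
have ex0 : exists m, `[< unavoidable_sizes k n e m >].
  exists 0; apply/asboolP; exists void, finset.set0; split; last exact: cards0.
    by move=> A; rewrite inE.
  move=> V G' _ _ _; exists (fun x : void => match x with end); first by case.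
  by move=> A; rewrite inE.
have ubb m : `[< unavoidable_sizes k n e m >] -> m <= e.
  by move/asboolP; exact: ub.
rewrite /un; case: xgetP => [m _ //|no].
case: (ex_maxnP ex0 ubb) => m /asboolP Sm mmax.
case: (no m); split=> // m' Sm'; apply: mmax; exact/asboolP.
Qed.

(* Main.v *)
(* If H is (n, e)-unavoidable then H embeds in every 4-graph with at least e
   edges. A clique on O(e^(1/4)) vertices bounds the number v of non-isolated
   vertices of H by O(e^(1/4)). For e >= n^3, the sets meeting a fixed set of
   O(e/n^3) vertices, together with a disjoint union of cliques of size
   O((e/n)^(1/3)), give v = O((e/n^3) (e/n)^(1/3)) = O(e^(4/3)/n^(10/3)).
   Finally, a random 4-graph with e edges contains a fixed copy of H with
   probability at most (e/N)^m, where m is the number of edges of H and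
   N = C(n, 4), and there are at most n^v copies; hence
   m log(N/e) <= v log n. In the range of (i), N/e >= n^(1/2), so m <= 2v. *)
Require Import Defs.
From mathcomp Require Import all_boot all_order all_algebra.
From mathcomp Require Import all_classical all_reals all_analysis.
From mathcomp Require Import zify ring lra.

Import Order.TTheory GRing.Theory Num.Theory.

Local Open Scope nat_scope.

(** * Copies in larger host graphs and the clique bound *)

(** Any [e] members of [F] form a graph to which unavoidability applies, and the copy found there
    lies in [F]. *)
Lemma contains_copy_family (k n e : nat) (W : finType) (H : {set {set W}})
    (F : {set {set 'I_n}}) :
  uniform k F -> unavoidable k n e H -> e <= #|F| -> contains_copy H F.
Proof.
move=> Fk Hun leF.
have szF : size (take e (enum F)) = e by rewrite size_takel // -cardE.
have subF : {subset take e (enum F) <= F}.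
  by move=> A /mem_take; rewrite mem_enum.
have [||f finj fH] := Hun 'I_n [set A in take e (enum F)] (card_ord n).
- by move=> A; rewrite inE => /subF /Fk.
- by rewrite cardsE (card_uniqP _) // take_uniq ?enum_uniq.
by exists f => // A /fH; rewrite inE => /subF.
Qed.

Lemma card_ord_lt (n j : nat) : j <= n -> #|[set x : 'I_n | x < j]| = j.
Proof.
move=> le_jn.
have -> : [set x : 'I_n | x < j] = widen_ord le_jn @: [set: 'I_j].
  apply/setP => x; rewrite inE; apply/idP/imsetP => [lt_xj | [y _ ->]] //=.
  by exists (Ordinal lt_xj); [rewrite finset.in_setT | exact: ord_inj].
rewrite card_imset ?cardsT ?card_ord // => x y /(congr1 val) /= ?.
exact: ord_inj.
Qed.

Lemma card_cover_clique (k j n e : nat) (W : finType) (H : {set {set W}}) :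
  unavoidable k n e H -> e <= 'C(j, k) -> j <= n -> #|finset.cover H| <= j.
Proof.
move=> Hun le_e le_jn; set P := [set x : 'I_n | x < j].
pose F := [set A : {set 'I_n} | A \subset P & #|A| == k].
have Fk : uniform k F by move=> A; rewrite inE => /andP[_ /eqP].
have [|f finj fH] := contains_copy_family _ _ _ _ _ F Fk Hun.
  by rewrite cards_draws card_ord_lt.
rewrite -(card_imset (mem (finset.cover H)) finj) -(card_ord_lt _ _ le_jn).
apply/subset_leq_card/fintype.subsetP => _ /imsetP[x /finset.bigcupP[A AH xA] ->].
have := fH _ AH; rewrite inE => /andP[/fintype.subsetP + _]; apply.
exact: imset_f.
Qed.

(** * The union bound over copies of [H] *)

Lemma card_bigcup_leq (I T : finType) (P : pred I) (F : I -> {set T}) :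
  #|\bigcup_(i | P i) F i| <= \sum_(i | P i) #|F i|.
Proof.
elim/big_rec2: _ => [|i m A _ le_Am]; first by rewrite cards0.
by rewrite (leq_trans (leq_card_setU _ _)) // leq_add2l.
Qed.

(** Removing [S] is injective on these sets and lands among the subsets of [E :\: S] with [e - #|S|]
    elements. *)
Lemma card_supersets (T : finType) (E S : {set T}) (e : nat) : S \subset E ->
  #|[set G : {set T} | [&& S \subset G, G \subset E & #|G| == e]]|
    <= 'C(#|E| - #|S|, e - #|S|).
Proof.
move=> SE.
rewrite -(finset.setIidPr SE) -cardsD (finset.setIidPr SE) -cards_draws.
set L := [set G | _]; set D := [set G | _].
have inj : {in L &, injective (fun G => G :\: S)}.
  move=> G1 G2; rewrite !inE => /and3P[S1 _ _] /and3P[S2 _ _] eqD.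
  rewrite -(finset.setID G1 S) -(finset.setID G2 S) eqD.
  by rewrite (finset.setIidPr S1) (finset.setIidPr S2).
rewrite -(card_in_imset inj); apply/subset_leq_card/fintype.subsetP.
move=> _ /imsetP[G /[!inE] /and3P[SG GE /eqP <-] ->].
by rewrite finset.setSD //= cardsD (finset.setIidPr SG).
Qed.

(** A random [e]-subset of [N] points contains [m] given points with probability the product of
    [(e - i) / (N - i)] over [i < m], and each factor is at most [e / N]. *)
Lemma bin_sub_ratio (N e m : nat) : e <= N -> m <= e ->
  'C(N - m, e - m) * N ^ m <= 'C(N, e) * e ^ m.
Proof.
move=> le_eN; elim: m => [|m IH] lt_me; first by rewrite !subn0.
have {}IH := IH (ltnW lt_me).
have Nm_gt0 : 0 < N - m by rewrite subn_gt0 (leq_trans lt_me).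
have := mul_bin_diag (N - m) (e - m.+1).
rewrite -subnS -[(e - m.+1).+1]subSn // subSS => E.
rewrite -(leq_pmul2l Nm_gt0) !expnSr.
have -> : (N - m) * ('C(N - m.+1, e - m.+1) * (N ^ m * N)) =
  ('C(N - m, e - m) * N ^ m) * ((e - m) * N) by rewrite mulnA E; nia.
have -> : (N - m) * ('C(N, e) * (e ^ m * e)) =
  ('C(N, e) * e ^ m) * ((N - m) * e) by nia.
by apply: leq_mul => //; nia.
Qed.

(* The restriction of the vertex map to the non-isolated vertices of [H]
   determines the copy, so there are at most [n ^ #|cover H|] copies. *)
Lemma unavoidable_counting (k n e : nat) (W : finType) (H : {set {set W}}) :
  0 < n -> e <= 'C(n, k) -> uniform k H -> unavoidable k n e H ->
  'C(n, k) ^ #|H| <= n ^ #|finset.cover H| * e ^ #|H|.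
Proof.
case: n => // n _ le_e Hk Hun.
pose E := [set A : {set 'I_n.+1} | #|A| == k].
have cardE : #|E| = 'C(n.+1, k) by rewrite card_draws card_ord.
pose Q := [set G : {set {set 'I_n.+1}} | G \subset E & #|G| == e].
have cardQ : #|Q| = 'C('C(n.+1, k), e) by rewrite cards_draws cardE.
pose copy (f : {ffun W -> 'I_n.+1}) := [set f @: (A : {set W}) | A in H].
pose M := [set f : {ffun W -> 'I_n.+1} |
  f \in pffun_on ord0 (mem (finset.cover H)) predT].
pose I := [set S in copy @: M | (S \subset E) && (#|S| == #|H|)].
have cardI : #|I| <= n.+1 ^ #|finset.cover H|.
  apply: leq_trans (subset_leq_card _) _.
    by apply/fintype.subsetP => S; rewrite inE => /andP[+ _]; exact: id.
  apply: leq_trans (leq_imset_card _ _) _.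
  by rewrite cardsE card_pffun_on card_ord.
have exI G : G \in Q -> exists2 S, S \in I & S \subset G /\ #|H| <= e.
  rewrite inE => /andP[GE /eqP Ge].
  have Gk : uniform k G.
    by move=> A /(fintype.subsetP GE); rewrite inE => /eqP.
  have [f finj fH] := Hun _ G (card_ord _) Gk Ge.
  (* Resetting [f] to [ord0] on isolated vertices may destroy injectivity but leaves the image of
     every edge unchanged. *)
  pose g := [ffun x => if x \in finset.cover H then f x else ord0].
  have gf A : A \in H -> g @: A = f @: A.
    move=> AH; apply: eq_in_imset => x xA; rewrite ffunE.
    by rewrite (_ : x \in _) //; apply/finset.bigcupP; exists A.
  have cE : copy g = [set f @: (A : {set W}) | A in H] by exact: eq_in_imset.
  have SG : copy g \subset G.
    by rewrite cE; apply/fintype.subsetP => _ /imsetP[A AH ->]; exact: fH.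
  have cS : #|copy g| = #|H| by rewrite cE card_imset //; exact: imset_inj.
  exists (copy g); last by rewrite -cS -Ge subset_leq_card.
  rewrite inE (fintype.subset_trans SG GE) cS eqxx andbT imset_f // inE.
  apply/pffun_onP; split=> [|x //].
  apply/fintype.subsetP => x; rewrite !inE ffunE.
  by case: ifP => //; rewrite eqxx.
have le_me : #|H| <= e.
  have : 0 < #|Q| by rewrite cardQ bin_gt0.
  by case/card_gt0P => G /exI[S _ []].
have le_count : 'C('C(n.+1, k), e) <=
    n.+1 ^ #|finset.cover H| * 'C('C(n.+1, k) - #|H|, e - #|H|).
  (* Every graph with [e] edges contains some copy in [I], so the graphs are counted copy by
     copy. *)
  have QU : Q \subset \bigcup_(S in I) [set G in Q | S \subset G].
    apply/fintype.subsetP => G GQ; have [S SI [SG _]] := exI _ GQ.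
    by apply/finset.bigcupP; exists S; rewrite // inE GQ.
  rewrite -cardQ (leq_trans (subset_leq_card QU)) //.
  rewrite (leq_trans (card_bigcup_leq _ _ _ _)) //.
  apply: (@leq_trans (\sum_(S in I) 'C('C(n.+1, k) - #|H|, e - #|H|))).
    apply: leq_sum => S; rewrite inE => /and3P[_ SE /eqP <-].
    rewrite -cardE (leq_trans _ (card_supersets _ _ _ e SE)) //.
    apply/subset_leq_card/fintype.subsetP => G.
    by rewrite !inE => /andP[/andP[-> ->] ->].
  by rewrite sum_nat_const leq_mul2r cardI orbT.
have C_gt0 : 0 < 'C('C(n.+1, k), e) by rewrite bin_gt0.
rewrite -(leq_pmul2l C_gt0) (leq_trans (leq_mul le_count (leqnn _))) //.
by rewrite -mulnA [leqRHS]mulnCA leq_mul2l bin_sub_ratio ?orbT.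
Qed.

(** * The two sparse host graphs: edges meeting a small set, and disjoint cliques *)

Definition meeting (k n j : nat) : {set {set 'I_n}} :=
  [set A : {set 'I_n} | #|A| == k & [exists x in A, x < j]].

Lemma card_meeting (k n j : nat) : j <= n ->
  #|meeting k n j| = 'C(n, k) - 'C(n - j, k).
Proof.
move=> le_jn; pose P := ~: [set x : 'I_n | x < j].
pose D := [set A : {set 'I_n} | A \subset P & #|A| == k].
have cardP : #|P| = n - j.
  by rewrite cardsCs finset.setCK card_ord_lt // card_ord.
have -> : meeting k n j = [set A : {set 'I_n} | #|A| == k] :\: D.
  apply/setP => A; rewrite !inE negb_and; case: (#|A| == k); rewrite ?andbF //=.
  rewrite orbF andbT; apply/existsP/subsetPn => -[x].
    by case/andP=> xA lt_xj; exists x; rewrite // !inE negbK.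
  by rewrite !inE negbK => xA lt_xj; exists x; rewrite xA.
rewrite cardsD card_draws card_ord (finset.setIidPr _) ?cards_draws ?cardP //.
by apply/fintype.subsetP => A; rewrite !inE => /andP[].
Qed.

Definition block (n s b : nat) : {set 'I_n} := [set x : 'I_n | x %/ s == b].

Lemma card_block_leq (n s b : nat) : 0 < s -> #|block n s b| <= s.
Proof.
move=> s_gt0; pose r (x : 'I_n) := Ordinal (ltn_pmod x s_gt0).
rewrite -[leqRHS]card_ord -(@card_in_imset _ _ r (mem (block n s b))).
  exact: max_card.
move=> x y; rewrite !inE => /eqP xb /eqP yb /(congr1 val) /= xy.
by apply: ord_inj; rewrite (divn_eq x s) (divn_eq y s) xb yb xy.
Qed.

Lemma card_block (n s b : nat) : 0 < s -> b < n %/ s -> #|block n s b| = s.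
Proof.
move=> s_gt0 lt_b; apply/eqP; rewrite eqn_leq card_block_leq //=.
have le_n : b.+1 * s <= n.
  by rewrite (leq_trans _ (leq_divM n s)) ?leq_mul2r ?lt_b ?orbT.
have lt_n (i : 'I_s) : b * s + i < n.
  by rewrite (leq_trans _ le_n) // mulSn addnC ltn_add2r.
pose h i : 'I_n := Ordinal (lt_n i).
rewrite -{1}(card_ord s) -cardsT -(@card_imset _ _ h); last first.
  by move=> i j /(congr1 val) /= /addnI /ord_inj.
apply/subset_leq_card/fintype.subsetP => _ /imsetP[i _ ->].
by rewrite inE /= divnMDl // divn_small // addn0.
Qed.

(** The index [b] runs over the full blocks; the incomplete last block carries no edges. *)
Definition in_block (k n s : nat) : {set {set 'I_n}} :=
  \bigcup_(b : 'I_(n %/ s))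
    [set A : {set 'I_n} | A \subset block n s b & #|A| == k].

Lemma card_in_block (k n s : nat) : 0 < k -> 0 < s ->
  #|in_block k n s| = n %/ s * 'C(s, k).
Proof.
move=> k_gt0 s_gt0; rewrite -sum1_card partition_disjoint_bigcup.
  under eq_bigr do rewrite sum1_card cards_draws card_block //.
  by rewrite sum_nat_const card_ord.
move=> b c; apply: contraNT => /pred0Pn[A /=]; rewrite !inE.
case/andP=> /andP[/fintype.subsetP Ab /eqP Ak] /andP[/fintype.subsetP Ac _].
have /card_gt0P[x xA] : 0 < #|A| by rewrite Ak.
by move: (Ab _ xA) (Ac _ xA); rewrite !inE => /eqP -> /eqP/val_inj ->.
Qed.

(* Embedded among the sets meeting [{0, ..., j-1}], [H] is covered by [j]
   vertices; embedded in a disjoint union of [s]-cliques, each of these vertices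
   accounts for the at most [s] non-isolated vertices of its clique. *)
Lemma card_cover_blocks (k j s n e : nat) (W : finType) (H : {set {set W}}) :
  0 < k -> 0 < s -> j <= n -> unavoidable k n e H ->
  e <= 'C(n, k) - 'C(n - j, k) -> e <= n %/ s * 'C(s, k) ->
  #|finset.cover H| <= j * s.
Proof.
move=> k_gt0 s_gt0 le_jn Hun; rewrite -card_meeting // -card_in_block // => le1 le2.
have [|f1 f1inj f1H] := contains_copy_family _ _ _ _ _ _ _ Hun le1.
  by move=> A; rewrite inE => /andP[/eqP].
have [|f2 f2inj f2H] := contains_copy_family _ _ _ _ _ _ _ Hun le2.
  by move=> A /finset.bigcupP[b _]; rewrite inE => /andP[_ /eqP].
pose K := [set w | f1 w < j].
have cardK : #|K| <= j.
  rewrite -(card_imset (mem K) f1inj) -(card_ord_lt _ _ le_jn).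
  by apply/subset_leq_card/fintype.subsetP => _ /imsetP[w + ->]; rewrite !inE.
have sub : finset.cover H \subset
    \bigcup_(w in K) [set x | f2 x \in block n s (f2 w %/ s)].
  apply/fintype.subsetP => x /finset.bigcupP[A AH xA].
  have := f1H A AH; rewrite inE => /andP[_ /existsP[_ /andP[/imsetP[w wA ->] wj]]].
  have /finset.bigcupP[b _] := f2H A AH; rewrite inE => /andP[/fintype.subsetP fAb _].
  apply/finset.bigcupP; exists w; rewrite ?inE //.
  have := fAb _ (imset_f f2 wA); have := fAb _ (imset_f f2 xA).
  by rewrite !inE => /eqP -> /eqP ->.
rewrite (leq_trans (subset_leq_card sub)) // (leq_trans (card_bigcup_leq _ _ _ _)) //.
apply: (@leq_trans (\sum_(w in K) s));
  last by rewrite sum_nat_const leq_mul2r cardK orbT.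
apply: leq_sum => w _; apply: leq_trans (card_block_leq n s (f2 w %/ s) s_gt0).
rewrite -(card_imset _ f2inj); apply/subset_leq_card/fintype.subsetP.
by move=> _ /imsetP[x + ->]; rewrite inE.
Qed.

(** * Estimates for binomial coefficients *)

Lemma expn4_leq_bin (n : nat) : 8 <= n -> n ^ 4 <= 384 * 'C(n, 4).
Proof.
move=> n8; have := bin_ffact n 4; rewrite !ffactnS ffactn0 !factS fact0 => E.
(* Here 384 is 4! times 2 * 2 * 4, and these three factors lift [n - 1], [n - 2], [n - 3] to at
   least [n]. *)
have -> : 384 * 'C(n, 4) = (n * (2 * n.-1)) * ((2 * n.-2) * (4 * n.-2.-1)) by lia.
have -> : n ^ 4 = (n * n) * (n * n) by rewrite !expnS expn0 muln1 !mulnA.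
by apply: leq_mul; apply: leq_mul; lia.
Qed.

Lemma expn3_leq_bin (n : nat) : 4 <= n -> n ^ 3 <= 24 * 'C(n, 3).
Proof.
move=> n4; have := bin_ffact n 3; rewrite !ffactnS ffactn0 !factS fact0 => E.
have -> : 24 * 'C(n, 3) = n * ((2 * n.-1) * (2 * n.-2)) by lia.
by rewrite !expnS expn0 muln1; apply: leq_mul => //; apply: leq_mul; lia.
Qed.

(** By Pascal's rule the difference telescopes into [j] terms ['C(n - i, k)] with [1 <= i <= j], the
    smallest being ['C(n - j, k)]. *)
Lemma leq_mul_bin_sub (k n j : nat) : j <= n ->
  j * 'C(n - j, k) <= 'C(n, k.+1) - 'C(n - j, k.+1).
Proof.
move=> le_jn; rewrite leq_subRL ?leq_bin2l ?leq_subr //.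
elim: j le_jn => [|j IH] lt_jn; first by rewrite subn0 mul0n addn0.
apply: leq_trans (IH (ltnW lt_jn)).
have -> : n - j = (n - j.+1).+1 by lia.
have := leq_mul (leqnn j) (leq_bin2l k (leqnSn (n - j.+1))).
by rewrite binS mulSn; lia.
Qed.

(** The least [k] with [e <= 'C(k, 4)] works: ['C(k.-1, 4) < e] bounds [k.-1], and passing from
    [k.-1] to [k] costs at most a factor [2 ^ 4]. *)
Lemma bin4_inverse (n e : nat) : 0 < e -> e <= 'C(n, 4) ->
  exists k, [/\ k <= n, e <= 'C(k, 4) & k ^ 4 <= 16 * (384 * e)].
Proof.
move=> e_gt0 le_e; have ex : exists k, e <= 'C(k, 4) by exists n.
case: (ex_minnP ex) => k ek kmin; exists k; split; rewrite ?kmin //.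
have [k8|k9] := leqP k 8.
  apply: (@leq_trans (8 ^ 4)); first by rewrite leq_exp2r.
  by rewrite !expnS expn0; lia.
have lt_e : 'C(k.-1, 4) < e.
  by rewrite ltnNge; apply/negP => /kmin; lia.
apply: (@leq_trans ((2 * k.-1) ^ 4)); first by rewrite leq_exp2r //; lia.
have k8 : 8 <= k.-1 by lia.
rewrite expnMn leq_mul // (leq_trans (expn4_leq_bin _ k8)) //.
by rewrite leq_mul2l ltnW ?orbT.
Qed.

(** * Range (i) in integer arithmetic *)

(** The hypothesis [N / e >= n^(1/2)] is squared to stay in the integers. Squaring the counting
    bound and multiplying by [n ^ m] gives [n ^ m * N ^ (2 * m) <= n ^ (2 * v) * (e ^ 2 * n) ^ m],
    where the last factor is at most [N ^ (2 * m)]. *)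
Lemma card_leq_cover (n e : nat) (W : finType) (H : {set {set W}}) :
  1 < n -> 0 < e -> e <= 'C(n, 4) -> e ^ 2 * n <= 'C(n, 4) ^ 2 ->
  uniform 4 H -> unavoidable 4 n e H -> #|H| <= 2 * #|finset.cover H|.
Proof.
move=> n1 e0 le_e le_sq Hk Hun.
have := unavoidable_counting _ _ _ _ _ (ltnW n1) le_e Hk Hun.
set m := #|H|; set v := #|_|; set N := 'C(n, 4) => le_count.
have N_gt0 : 0 < N by exact: leq_trans le_e.
rewrite -(leq_exp2l _ _ n1) -(@leq_pmul2r (N ^ (2 * m))) ?expn_gt0 ?N_gt0 //.
have le2 : N ^ (2 * m) <= n ^ (2 * v) * e ^ (2 * m).
  by rewrite ![2 * _]mulnC !expnM -expnMn leq_exp2r.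
apply: (leq_trans (leq_mul (leqnn _) le2)).
rewrite mulnCA leq_mul2l; apply/orP; right.
by rewrite mulnC !expnM -expnMn; case: m {le_count le2} => // m; rewrite leq_exp2r.
Qed.

Lemma unavoidable_sparse (n e : nat) (W : finType) (H : {set {set W}}) :
  8 <= n -> n ^ 3 <= e -> 768 * e <= n ^ 4 -> (384 * e) ^ 2 * n <= (n ^ 4) ^ 2 ->
  uniform 4 H -> unavoidable 4 n e H ->
  exists j s, [/\ j * n ^ 3 <= 193 * e, n * s ^ 3 <= 8 * (768 * e) &
                  #|H| <= 2 * (j * s)].
Proof.
move=> n8 le_n3e le_en4 le_sq Hk Hun.
have n3_gt0 : 0 < n ^ 3 by rewrite expn_gt0; lia.
have e_gt0 : 0 < e by exact: leq_trans le_n3e.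
have leN := expn4_leq_bin _ n8.
have n4E : n ^ 4 = n * n ^ 3 by rewrite expnS.
have exs : exists s, 768 * e <= n * s ^ 3 by exists n; rewrite -n4E.
(* The clique size is the least [s] of order [(e / n)^(1/3)]; minimality gives the matching upper
   bound. *)
case: (ex_minnP exs) => s le_es smin.
have le_sn : s <= n by apply: smin; rewrite -n4E.
have s8 : 8 <= s.
  rewrite leqNgt; apply/negP => s7.
  have : n * s ^ 3 <= n * 7 ^ 3 by rewrite leq_mul // leq_exp2r.
  rewrite (_ : 7 ^ 3 = 343) // => s343.
  have : n * 8 ^ 2 <= n ^ 3 by rewrite (expnS n) leq_mul // leq_exp2r.
  rewrite (_ : 8 ^ 2 = 64) //; lia.
have lt_s : n * s.-1 ^ 3 < 768 * e.
  by rewrite ltnNge; apply/negP => /smin; lia.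
(* Once [2 * j <= n], ['C(n - j, 3) >= n ^ 3 / (24 * 8)], whence the 192. The added 1 costs
   [n ^ 3 <= e], whence the 193. *)
pose j := (192 * e) %/ n ^ 3 + 1.
have le_j : j * n ^ 3 <= 193 * e.
  by rewrite mulnDl mul1n; have := leq_divM (192 * e) (n ^ 3); lia.
have gt_j : 192 * e <= j * n ^ 3.
  by rewrite /j addn1 ltnW // ltn_ceil.
have le_jn : 2 * j <= n.
  have : 4 * ((192 * e) %/ n ^ 3) <= n.
    rewrite -(leq_pmul2r n3_gt0) -n4E -mulnA.
    by have := leq_divM (192 * e) (n ^ 3); lia.
  by rewrite /j; lia.
have e1 : e <= 'C(n, 4) - 'C(n - j, 4).
  apply: leq_trans (leq_mul_bin_sub _ _ _ _); last by lia.
  have /expn3_leq_bin le3 : 4 <= n - j by lia.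
  have : n ^ 3 <= (2 * (n - j)) ^ 3 by rewrite leq_exp2r //; lia.
  rewrite expnMn (_ : 2 ^ 3 = 8) // => le8.
  have : n ^ 3 <= 192 * 'C(n - j, 3) by lia.
  move/(leq_mul (leqnn j)); lia.
(* The 768 is 2 * 384: rounding [n %/ s] loses at most a factor 2, and [s ^ 4 <= 384 * 'C(s, 4)]. *)
have e2 : e <= n %/ s * 'C(s, 4).
  have s_gt0 : 0 < s by lia.
  have := expn4_leq_bin _ s8; rewrite expnS => le4.
  have le_q : n <= 2 * (n %/ s) * s.
    have q_gt0 : 0 < n %/ s by rewrite divn_gt0.
    by rewrite (leq_trans (ltnW (ltn_ceil n s_gt0))) // leq_mul //; lia.
  rewrite -(@leq_pmul2l 768) // (leq_trans le_es) //.
  rewrite -(leq_pmul2l s_gt0) mulnCA (leq_trans (leq_mul le_q le4)) //.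
  lia.
exists j, s; split => //.
  have le_s : n * s ^ 3 <= n * (2 * s.-1) ^ 3.
    by rewrite leq_mul // leq_exp2r //; clear -s8; lia.
  rewrite (leq_trans le_s) // expnMn (_ : 2 ^ 3 = 8) //.
  by rewrite mulnCA leq_mul2l ltnW ?orbT.
have le_cover : #|finset.cover H| <= j * s.
  by apply: card_cover_blocks Hun e1 e2 => //; [exact: leq_trans s8 | clear -le_jn; lia].
have n_gt1 : 1 < n by exact: leq_trans n8.
have le_C : e <= 'C(n, 4) by clear -le_en4 leN; lia.
apply: leq_trans (card_leq_cover _ _ _ _ n_gt1 e_gt0 le_C _ Hk Hun) _.
  rewrite -(@leq_pmul2l (384 ^ 2)) ?expn_gt0 // mulnA -!expnMn.
  by rewrite (leq_trans le_sq) // leq_exp2r.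
by rewrite leq_mul2l le_cover orbT.
Qed.

(** * Real exponents and the final constants *)

Local Open Scope ring_scope.

Lemma powR_root (R : realType) (k : nat) (x : R) : (0 < k)%N -> 0 <= x ->
  (x `^ (1 / k%:R)) ^+ k = x.
Proof.
move=> k_gt0 x_ge0; rewrite -powR_mulrn ?powR_ge0 // -powRrM div1r.
by rewrite mulVf ?powRr1 // pnatr_eq0 -lt0n.
Qed.

Theorem theorem5p10 (R : realType) :
  (exists C0 c0 D : R, exists N : nat,
    [/\ 0 < C0, 0 < c0, 0 < D &
     forall n e : nat, (N <= n)%N ->
       C0 * n%:R ^+ 3 <= e%:R -> e%:R <= c0 * n%:R `^ (40 / 13) ->
       (un 4 n e)%:R <= D * (e%:R `^ (4 / 3) / n%:R `^ (10 / 3))])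
  /\
  (exists C1 D : R, exists N : nat,
    [/\ 0 < C1, 0 < D &
     forall n e : nat, (N <= n)%N ->
       C1 * n%:R `^ (40 / 13) <= e%:R -> (e <= 'C(n, 4))%N ->
       (* at e = 'C(n, 4) the denominator is 0 and the quotient is +oo *)
       ((un 4 n e)%:R%:E <=
         D%:E * ((e%:R `^ (1 / 4) * ln n%:R)%:E
                 / (ln ('C(n, 4)%:R / e%:R))%:E))%E]).
Proof.
split.
  (* [D] is 2 * 193 * 20, with 20 an upper bound for the cube root of 8 * 768 = 6144. *)
  exists 1, (1 / 768), 7720, 8%N; split; [lra|lra|lra|] => n e n8.
  rewrite mul1r -natrX ler_nat => le_n3e le_e.
  have n_ge1 : 1 <= n%:R :> R by rewrite ler1n; lia.
  have n_gt0 : 0 < n%:R :> R by lra.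
  (* As 40/13 <= 7/2, [e] is below [n^(7/2)], whose square times [n] is [n^8], the form that [le_sq]
     requires. *)
  have le_w : 768 * e%:R <= n%:R `^ (7 / 2) :> R.
    have : n%:R `^ (40 / 13) <= n%:R `^ (7 / 2) :> R by apply: ler_powR => //; lra.
    by lra.
  have w2 : (n%:R `^ (7 / 2)) ^+ 2 = n%:R ^+ 7 :> R.
    rewrite -!powR_mulrn ?powR_ge0 ?(ltW n_gt0) // -powRrM.
    by congr (_ `^ _); field.
  have le_e4 : (768 * e <= n ^ 4)%N.
    rewrite -(ler_nat R) natrM natrX (le_trans le_w) // -powR_mulrn ?(ltW n_gt0) //.
    by apply: ler_powR => //; lra.
  have le_sq : ((384 * e) ^ 2 * n <= (n ^ 4) ^ 2)%N.
    rewrite -expnM -[(4 * 2)%N]/7.+1 (expnSr n) leq_mul2r; apply/orP; right.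
    rewrite -(ler_nat R) natrX [leRHS]natrX -[leRHS]w2 lerXn2r ?nnegrE ?ler0n ?powR_ge0 //.
    by rewrite natrM; have := ler0n R e; lra.
  have le_C : (e <= 'C(n, 4))%N by have := expn4_leq_bin _ n8; lia.
  have [[W [H [Hk Hun <-]]] _] := un_max le_C.
  have [j [s [le_j le_s le_m]]] := unavoidable_sparse _ _ _ _ n8 le_n3e le_e4 le_sq Hk Hun.
  have e_ge0 := ler0n R e.
  (* With these cube roots the target quotient is [e * x / (n ^ 3 * y)], and the bounds on [j] and
     [s] multiply to it. *)
  pose x := (e%:R : R) `^ (1 / 3); pose y := (n%:R : R) `^ (1 / 3).
  have x3 : x ^+ 3 = e%:R by exact: powR_root.
  have y3 : y ^+ 3 = n%:R by apply: powR_root => //; exact: ltW.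
  have x_ge0 : 0 <= x by exact: powR_ge0.
  have y_gt0 : 0 < y by exact: powR_gt0.
  have eE : e%:R `^ (4 / 3) = e%:R * x :> R.
    rewrite -[X in _ = X * _]powRr1 // -powRD; first by congr (_ `^ _); field.
    by apply/implyP => /eqP; lra.
  have nE : n%:R `^ (10 / 3) = n%:R ^+ 3 * y :> R.
    rewrite -powR_mulrn ?(ltW n_gt0) // -powRD; first by congr (_ `^ _); field.
    by apply/implyP => _; exact: lt0r_neq0.
  have ys : s%:R * y <= 20 * x.
    rewrite -(@ler_pXn2r _ 3) ?nnegrE ?mulr_ge0 ?(ltW y_gt0) //.
    rewrite !exprMn x3 y3.
    move: le_s; rewrite -(ler_nat R) natrM natrX !natrM; lra.
  have jn : j%:R * n%:R ^+ 3 <= 193 * e%:R :> R.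
    by move: le_j; rewrite -(ler_nat R) natrM natrX natrM.
  have den_gt0 : 0 < n%:R ^+ 3 * y by rewrite mulr_gt0 ?exprn_gt0.
  rewrite eE nE mulrA ler_pdivlMr //.
  move: le_m; rewrite -(ler_nat R) !natrM => le_m.
  apply: le_trans (ler_wpM2r (ltW den_gt0) le_m) _.
  have jn_ge0 : 0 <= j%:R * n%:R ^+ 3 :> R by rewrite mulr_ge0 ?exprn_ge0.
  have ys_ge0 : 0 <= s%:R * y by rewrite mulr_ge0 // ltW.
  have := ler_pM jn_ge0 ys_ge0 jn ys.
  by lra.
(* [D = 10] because the clique has [k] vertices with [k ^ 4 <= 6144 * e <= 10 ^ 4 * e]. *)
exists 1, 10, 2%N; split; [lra|lra|] => n e n2 le_ne le_C.
have n_gt1 : 1 < n%:R :> R by rewrite ltr1n.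
have e_gt0 : (0 : R) < e%:R.
  by apply: lt_le_trans le_ne; rewrite mul1r powR_gt0 //; lra.
have e0 : (0 < e)%N by rewrite -(ltr0n R).
have lnn_gt0 : 0 < ln n%:R :> R by exact: ln_gt0.
have num_gt0 : 0 < e%:R `^ (1 / 4) * ln n%:R :> R by rewrite mulr_gt0 ?powR_gt0.
have [eqC|neqC] := eqVneq e 'C(n, 4).
  rewrite -eqC divff ?gt_eqF // ln1 inve0 gt0_muley ?lte_fin //.
  by rewrite gt0_muley ?lte_fin ?leey.
have lt_e : 1 < 'C(n, 4)%:R / e%:R :> R.
  by rewrite ltr_pdivlMr // mul1r ltr_nat ltn_neqAle neqC.
have L_gt0 : 0 < ln ('C(n, 4)%:R / e%:R) :> R by exact: ln_gt0.
rewrite inver gt_eqF // -!EFinM lee_fin mulrA ler_pdivlMr //.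
have [[W [H [Hk Hun <-]]] _] := un_max le_C.
have [k [le_kn le_ek le_k4]] := bin4_inverse _ _ e0 le_C.
have le_v := card_cover_clique _ _ _ _ _ _ Hun le_ek le_kn.
have le_count := unavoidable_counting _ _ _ _ _ (ltnW n2) le_C Hk Hun.
have C_gt0 : 0 < 'C(n, 4)%:R :> R by rewrite ltr0n; lia.
have n_gt0 : 0 < n%:R :> R by lra.
have le_ln : #|H|%:R * ln ('C(n, 4)%:R / e%:R) <= #|finset.cover H|%:R * ln n%:R :> R.
  rewrite [leLHS]mulr_natl [leRHS]mulr_natl -!lnXn ?divr_gt0 //.
  rewrite ler_ln ?posrE ?exprn_gt0 ?divr_gt0 //.
  rewrite expr_div_n ler_pdivrMr ?exprn_gt0 //.
  by move: le_count; rewrite -(ler_nat R) natrM !natrX.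
apply: le_trans le_ln _; rewrite mulrA ler_wpM2r ?(ltW lnn_gt0) //.
apply: (@le_trans _ _ k%:R); first by rewrite ler_nat.
rewrite -(@ler_pXn2r _ 4) ?nnegrE ?mulr_ge0 ?powR_ge0 //.
rewrite exprMn powR_root ?(ltW e_gt0) //.
by move: le_k4; rewrite -(ler_nat R) natrX !natrM; lra.
Qed.
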